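(* Let $n\ge 1$ and let $\pi=\pi_1\pi_2\cdots\pi_n\in\mathfrak{S}_n$ (one-line notation). Partition its ascent set $\mathrm{Asc}(\pi)=\{i\in[n-1]:\pi_i<\pi_{i+1}\}$ into maximal blocks $b_1,b_2,\ldots,b_k$ of consecutive integers. Then the number of Boolean intervals $[\pi,w]$ in the right weak order $W(\mathfrak{S}_n)$ with minimal element $\pi$ and arbitrary maximal element $w$ (including the case $w=\pi$) equals $$\prod_{i=1}^k F_{|b_i|+2},$$ where $F_\ell$ is the $\ell$-th Fibonacci number with $F_1=F_2=1$ (an empty product equals $1$).
   Context: $[n]=\{1,\ldots,n\}$. $s_i=(i,i+1)$ denotes a simple transposition. The right weak order $W(\mathfrak{S}_n)$ is the partial order on $\mathfrak{S}_n$ whose cover relations are $\tau\lessdot\tau s_i$ whenever $\tau(i)<\tau(i+1)$ (i.e. right multiplication by $s_i$ swaps two adjacent entries in increasing position order into decreasing order); its order relation is the transitive closure. An interval $[v,w]=\{u: v\le u\le w\}$ (with $v\le w$) is called a Boolean interval (of rank $k$) if it is isomorphic as a poset to the lattice of all subsets of a $k$-element set ordered by inclusion; $[\pi,\pi]$ is a Boolean interval of rank $0$. *)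

(* Defs.v *)
From mathcomp Require Import all_boot fingroup perm.
From mathcomp Require Import boolp.

Set Implicit Arguments.
Unset Strict Implicit.
Unset Printing Implicit Defensive.

(* Permutations of [n] are elements of 'S_n, with positions and values shifted
   to {0, ..., n-1}. *)

Definition Asc (n : nat) (pi : 'S_n) : {set 'I_n} :=
  [set i : 'I_n | [exists j : 'I_n, (j == i.+1 :> nat) && (pi i < pi j)]].

(* The MathComp product of permutations applies its left factor first, so
   (tperm i j * tau) x = tau (tperm i j x): this is the right multiplication
   tau s_i, which exchanges the adjacent entries at positions i and j = i + 1. *)
Definition weak_cover (n : nat) : rel 'S_n := fun tau sigma =>
  [exists i : 'I_n, exists j : 'I_n,
    [&& j == i.+1 :> nat, tau i < tau j & sigma == (tperm i j * tau)%g]].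

Definition weak_le (n : nat) : rel 'S_n := connect (@weak_cover n).

Definition interval (n : nat) (v w : 'S_n) : {set 'S_n} :=
  [set u : 'S_n | weak_le v u && weak_le u w].

Definition boolean_of_rank (n k : nat) (I : {set 'S_n}) : Prop :=
  exists f : {set 'I_k} -> 'S_n,
    [/\ injective f,
        f @: [set: {set 'I_k}] = I
      & forall X Y : {set 'I_k}, (X \subset Y) = weak_le (f X) (f Y)].

Definition boolean_interval (n : nat) (v w : 'S_n) : Prop :=
  weak_le v w /\ exists k : nat, boolean_of_rank k (interval v w).

Definition boolean_intervals_from (n : nat) (pi : 'S_n) : {set {set 'S_n}} :=
  [set interval pi w | w : 'S_n & `[< boolean_interval pi w >]].

Definition consecutive (n : nat) (B : {set 'I_n}) : bool :=
  [forall i in B, forall j in B, forall k : 'I_n, (i <= k <= j) ==> (k \in B)].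

Definition maximal_blocks (n : nat) (A : {set 'I_n}) : {set {set 'I_n}} :=
  [set B : {set 'I_n} |
    maxset (fun C : {set 'I_n} => [&& C != set0, C \subset A & consecutive C]) B].

Fixpoint fib (l : nat) : nat :=
  match l with
  | 0 => 0
  | 1 => 1
  | (l'.+1 as m).+1 => fib m + fib l'
  end.

(* Main.v *)
(** Call a set of positions sparse when it contains no two consecutive integers.
    The Boolean intervals above [pi] are the intervals [pi, w_S], where S is a
    sparse subset of Asc(pi) and w_S is obtained from [pi] by exchanging the
    entries at positions i and i+1 for every i in S.  Indeed a cover relation
    adds exactly one pair of values to the inversion set, and inversion sets
    grow along the weak order.  So below w_S each step creates an inversion
    (pi_i, pi_(i+1)) with i in S, which determines the transposition used.
    Conversely, in a Boolean interval the atoms are pi s_i for i in some set S;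
    two atoms pi s_i and pi s_(i+1) have no common upper bound covering both,
    so S is sparse, and the inversions of the atoms determine all other
    elements.  Finally, sparse subsets multiply over the maximal blocks, and for
    one block they satisfy the Fibonacci recurrence (is the largest element
    used or not). *)

Require Import Defs.
From mathcomp Require Import all_boot fingroup perm.
From mathcomp Require Import boolp zify.

Set Implicit Arguments.
Unset Strict Implicit.
Unset Printing Implicit Defensive.

(** * Sparse sets and the Fibonacci count on one block *)

Definition sparse (n : nat) (S : {set 'I_n}) : bool :=
  [forall i in S, forall j in S, j != i.+1 :> nat].

Definition sparse_subsets (n : nat) (A : {set 'I_n}) : {set {set 'I_n}} :=
  [set S : {set 'I_n} | (S \subset A) && sparse S].

Lemma sparseP (n : nat) (S : {set 'I_n}) :
  reflect (forall i j, i \in S -> j \in S -> j <> i.+1 :> nat) (sparse S).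
Proof.
apply: (iffP forall_inP) => [H i j iS jS|H i iS].
  by apply/eqP; move/forall_inP: (H i iS); apply.
by apply/forall_inP => j jS; apply/eqP/H.
Qed.

Lemma sparseS (n : nat) (S T : {set 'I_n}) :
  S \subset T -> sparse T -> sparse S.
Proof.
move=> /subsetP ST /sparseP H; apply/sparseP => i j /ST iT /ST jT; exact: H.
Qed.

Lemma sparse_subsetsS (n : nat) (A S T : {set 'I_n}) :
  S \subset T -> T \in sparse_subsets A -> S \in sparse_subsets A.
Proof.
rewrite !inE => ST /andP[TA spT].
by rewrite (subset_trans ST TA) (sparseS ST spT).
Qed.

Lemma sparse_subsets0 (n : nat) : #|sparse_subsets (@set0 'I_n)| = 1.
Proof.
rewrite (_ : sparse_subsets set0 = [set set0]) ?cards1 //.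
apply/setP => S; rewrite !inE subset0; case: eqP => //= ->.
by apply/sparseP => i j; rewrite inE.
Qed.

(** A sparse set containing the maximum [m] omits [m - 1], so removing [m] leaves a sparse set of
    elements below [m - 1]. *)
Lemma card_sparse_max (n : nat) (B : {set 'I_n}) (m : 'I_n) :
  m \in B -> (forall i, i \in B -> i <= m) ->
  #|sparse_subsets B| =
    #|sparse_subsets (B :\ m)| + #|sparse_subsets [set j in B | j.+1 < m]|.
Proof.
move=> mB maxm.
rewrite -(cardsID [set S : {set 'I_n} | m \in S] (sparse_subsets B)) addnC.
congr (_ + _).
  apply: eq_card => S; rewrite !inE subsetD1.
  by case: (m \in S); rewrite ?andbF ?andbT.
set D := [set j in B | j.+1 < m].
have mD T : T \in sparse_subsets D -> m \notin T.
  rewrite inE => /andP[/subsetP TD _]; apply/negP => /TD.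
  by rewrite inE => /andP[_]; lia.
rewrite -(@card_in_imset _ _ (fun T => m |: T) (mem (sparse_subsets D))); last first.
  by move=> T U /mD mT /mD mU e; rewrite -(setU1K mT) -(setU1K mU) e.
apply: eq_card => S; apply/idP/imsetP => [|[T TD ->]].
  rewrite !inE => /andP[/andP[/subsetP SB /sparseP spS] mS].
  exists (S :\ m); last by rewrite setD1K.
  rewrite inE (@sparseS _ (S :\ m) S) ?subD1set //; last exact/sparseP.
  rewrite andbT; apply/subsetP => j; rewrite !inE => /andP[jm jS].
  rewrite SB //=; have := maxm j (SB _ jS); have := spS j m jS mS.
  by move: jm; rewrite -val_eqE /=; lia.
have := TD; rewrite !inE eqxx /= andbT => /andP[/subsetP TsD /sparseP spT].
apply/andP; split.
  apply/subsetP => j; rewrite in_setU1 => /orP[/eqP -> //|/TsD].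
  by rewrite inE => /andP[].
apply/sparseP => i j; rewrite !in_setU1.
case/orP=> [/eqP ->|iT]; case/orP=> [/eqP ->|jT]; try lia.
- by have := TsD _ jT; rewrite inE => /andP[_]; lia.
- by have := TsD _ iT; rewrite inE => /andP[_]; lia.
- exact: spT.
Qed.

Lemma consecutiveP (n : nat) (B : {set 'I_n}) :
  reflect (forall i j k : 'I_n, i \in B -> j \in B -> i <= k <= j -> k \in B)
          (consecutive B).
Proof.
apply: (iffP forall_inP) => [H i j k iB jB|H i iB].
  by move/forall_inP: (H i iB) => /(_ j jB) /forallP /(_ k) /implyP.
by apply/forall_inP => j jB; apply/forallP => k; apply/implyP; apply: H.
Qed.

Lemma card_sparse_consecutive (n : nat) (B : {set 'I_n}) :
  consecutive B -> #|sparse_subsets B| = fib (#|B| + 2).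
Proof.
(* Strong induction through a bound [s], since the recurrence removes one or two elements. *)
move: {2}(#|B|) (leqnn #|B|) => s.
elim: s B => [|s IHs] B.
  by rewrite leqn0 cards_eq0 => /eqP-> _; rewrite sparse_subsets0 cards0.
move=> sB /consecutiveP cB.
have [->|/set0Pn[i0 i0B]] := eqVneq B set0.
  by rewrite sparse_subsets0 cards0.
case: (arg_maxnP (fun i : 'I_n => i : nat) i0B) => m /= mB maxm.
have {}mB : m \in B := mB.
rewrite (card_sparse_max mB maxm).
have cardBm : #|B| = #|B :\ m|.+1 by rewrite (cardsD1 m) mB.
rewrite IHs; [|lia|]; last first.
  apply/consecutiveP => i j k; rewrite !inE => /andP[_ iB] /andP[jm jB] ikj.
  rewrite (cB i j k) // andbT; apply: contraNneq jm => km; apply/eqP/val_inj => /=.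
  by have := maxm j jB; move: ikj; rewrite km; lia.
(* A singleton is treated apart, with count 1 + 1 = [fib 3]; otherwise a second element [a] below
   [m] forces [m - 1] into [B]. *)
have [B0|/set0Pn[a]] := eqVneq (B :\ m) set0.
  have -> : [set j in B | j.+1 < m] = set0.
    apply/setP => j; rewrite !inE; apply/negP => /andP[jB jm].
    have : j \in B :\ m by rewrite !inE jB andbT -val_eqE /=; lia.
    by rewrite B0 inE.
  by rewrite sparse_subsets0 cardBm B0 cards0.
rewrite !inE -val_eqE /= => /andP[am aB].
have lam : a < m by have := maxm a aB; simpl in *; lia.
have pm : m.-1 < n by have := ltn_ord m; lia.
have m'B : Ordinal pm \in B by apply: (cB a m) => //=; lia.
have eD : [set j in B | j.+1 < m] = B :\ m :\ Ordinal pm.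
  apply/setP => j; rewrite !inE -!val_eqE /=.
  case jB: (j \in B); rewrite ?andbF ?andbT //=.
  by have := maxm j jB; simpl; lia.
have cD : #|B :\ m| = #|[set j in B | j.+1 < m]|.+1.
  rewrite eD (cardsD1 (Ordinal pm) (B :\ m)) !inE m'B -val_eqE /=.
  by have -> : (m.-1 != m) by lia.
rewrite IHs; first by rewrite cardBm cD !addSn addnC [in RHS]/= addnC.
  by move: sB; rewrite cardBm cD; apply: ltnW.
apply/consecutiveP => i j k; rewrite !inE => /andP[iB _] /andP[jB jm] ikj.
by rewrite (cB i j k) //=; lia.
Qed.

(** * Products over maximal blocks *)

Definition separated (n : nat) (B C : {set 'I_n}) : Prop :=
  forall i j : 'I_n, i \in B -> j \in C -> i.+1 < j \/ j.+1 < i.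

(** The gap makes [B] and [C] disjoint and without consecutive elements across them, so a sparse
    subset of the union splits into two independent sparse sets. *)
Lemma card_sparseU (n : nat) (B C : {set 'I_n}) : separated B C ->
  #|sparse_subsets (B :|: C)| = #|sparse_subsets B| * #|sparse_subsets C|.
Proof.
move=> sepBC.
have dBC (S T : {set _}) : S \subset B -> T \subset C -> (S :|: T) :&: B = S.
  move=> SB /subsetP TC; rewrite setIUl (setIidPl SB).
  rewrite (_ : T :&: B = set0) ?setU0 //; apply/setP => x; rewrite !inE.
  by apply/negP => /andP[/TC xC xB]; have := sepBC x x xB xC; lia.
have dCB (S T : {set _}) : S \subset B -> T \subset C -> (S :|: T) :&: C = T.
  move=> /subsetP SB TC; rewrite setIUl (setIidPl TC).
  rewrite (_ : S :&: C = set0) ?set0U //; apply/setP => x; rewrite !inE.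
  by apply/negP => /andP[/SB xB xC]; have := sepBC x x xB xC; lia.
rewrite -cardsX -(@card_in_imset _ _ (fun p : {set 'I_n} * {set 'I_n} => p.1 :|: p.2)); last first.
  move=> [S T] [S' T']; rewrite !inE /= => /andP[/andP[SB _] /andP[TC _]].
  move=> /andP[/andP[SB' _] /andP[TC' _]] e.
  by rewrite -(dBC S T) // -{2}(dCB S T) // e dBC // dCB.
apply: eq_card => S; apply/idP/imsetP => [|[[X Y] /=]].
  rewrite inE => /andP[SBC spS]; exists (S :&: B, S :&: C); last first.
    by rewrite /= -setIUr (setIidPl SBC).
  by rewrite !inE /= !subsetIr !(sparseS _ spS) ?subsetIl.
rewrite !inE /= => /andP[/andP[XB /sparseP spX] /andP[YC /sparseP spY]] ->.
rewrite setUSS //=; apply/sparseP => i j; rewrite !inE.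
case/orP=> [iX|iY]; case/orP=> [jX|jY].
- exact: spX.
- by have := sepBC i j (subsetP XB _ iX) (subsetP YC _ jY); lia.
- by have := sepBC j i (subsetP XB _ jX) (subsetP YC _ iY); lia.
- exact: spY.
Qed.

Lemma card_sparse_cover (n : nat) (P : {set {set 'I_n}}) :
  {in P &, forall B C, B != C -> separated B C} ->
  #|sparse_subsets (cover P)| = \prod_(B in P) #|sparse_subsets B|.
Proof.
move: {2}(#|P|) (erefl #|P|) => s; elim: s P => [|s IHs] P.
  move/eqP; rewrite cards_eq0 => /eqP -> _.
  by rewrite /cover !big_set0 sparse_subsets0.
move=> cP sepP.
have /set0Pn[B BP] : P != set0 by rewrite -cards_eq0 cP.
have PB : cover P = B :|: cover (P :\ B) by rewrite /cover (big_setD1 B).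
rewrite PB card_sparseU ?(big_setD1 B BP) /= ?IHs //.
- by move: cP; rewrite (cardsD1 B) BP => -[].
- by move=> C D /setD1P[_ CP] /setD1P[_ DP]; apply: sepP.
- move=> i j iB /bigcupP[C /setD1P[CB CP] jC].
  by apply: (sepP B C) => //; rewrite eq_sym.
Qed.

(** The sets touch or overlap at [i] and [j], so a point between an element of one and an element of
    the other is caught either by the stretch of [B] ending at [i] or by that of [C] ending at
    [j]. *)
Lemma consecutiveU (n : nat) (B C : {set 'I_n}) (i j : 'I_n) :
  consecutive B -> consecutive C -> i \in B -> j \in C ->
  i <= j.+1 -> j <= i.+1 -> consecutive (B :|: C).
Proof.
move=> /consecutiveP cB /consecutiveP cC iB jC ij ji.
apply/consecutiveP => a b k; rewrite !inE => aBC bBC akb.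
case/orP: aBC => aX; case/orP: bBC => bX.
- by rewrite (cB a b).
- case: (leqP k i) => ki; first by rewrite (cB a i) //; lia.
  by rewrite (cC j b) ?orbT //; lia.
- case: (leqP k j) => kj; first by rewrite (cC a j) ?orbT //; lia.
  by rewrite (cB i b) //; lia.
- by rewrite (cC a b) ?orbT.
Qed.

Lemma maximal_blocksP (n : nat) (A B : {set 'I_n}) : B \in maximal_blocks A ->
  [/\ B != set0, B \subset A & consecutive B].
Proof. by rewrite inE => /maxsetp /and3P. Qed.

Lemma cover_maximal_blocks (n : nat) (A : {set 'I_n}) :
  cover (maximal_blocks A) = A.
Proof.
apply/setP => x; apply/bigcupP/idP => [[B /maximal_blocksP[_ /subsetP BA _]]|xA].
  exact: BA.
pose P (C : {set 'I_n}) := [&& C != set0, C \subset A & consecutive C].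
have Px : P [set x].
  apply/and3P; split; first by apply/set0Pn; exists x; rewrite inE.
    by rewrite sub1set.
  apply/consecutiveP => i j k; rewrite !inE => /eqP -> /eqP -> xkx.
  by rewrite -val_eqE /=; lia.
have [B maxB] := maxset_exists Px; rewrite sub1set => xB.
by exists B => //; rewrite inE.
Qed.

(** If two blocks touched or overlapped, their union would be consecutive, and maximality would make
    both equal to it. *)
Lemma maximal_blocks_separated (n : nat) (A : {set 'I_n}) :
  {in maximal_blocks A &, forall B C, B != C -> separated B C}.
Proof.
move=> B C BA CA BC i j iB jC.
case: (ltnP i.+1 j) => [|ji]; first by left.
case: (ltnP j.+1 i) => [|ij]; first by right.
have [B0 sBA cB] := maximal_blocksP BA; have [_ sCA cC] := maximal_blocksP CA.
have PU : [&& B :|: C != set0, B :|: C \subset A & consecutive (B :|: C)].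
  rewrite subUset sBA sCA (consecutiveU cB cC iB jC) // !andbT.
  by apply/set0Pn; exists i; rewrite inE iB.
move: BA CA BC; rewrite !inE => BA CA.
by rewrite -(maxsetsup BA PU (subsetUl _ _)) -{2}(maxsetsup CA PU (subsetUr _ _)) eqxx.
Qed.

Lemma card_sparse_blocks (n : nat) (A : {set 'I_n}) :
  #|sparse_subsets A| = \prod_(B in maximal_blocks A) fib (#|B| + 2).
Proof.
rewrite -{1}(cover_maximal_blocks A).
rewrite (card_sparse_cover (@maximal_blocks_separated n A)).
apply: eq_bigr => B /maximal_blocksP[_ _ cB].
exact: card_sparse_consecutive.
Qed.

(** * Simultaneous adjacent exchanges *)

(* [adj_starts S] never contains both [i] and [ordS i], whatever [S] is, so that
   [adj_swap S] is an involution without any hypothesis; on sparse subsets of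
   the ascent set, [adj_starts S] is [S] itself. *)
Definition adj_starts (n : nat) (S : {set 'I_n}) : {set 'I_n} :=
  [set i in S | ord_pred i \notin S].

Definition adj_swap (n : nat) (S : {set 'I_n}) (x : 'I_n) : 'I_n :=
  if x \in adj_starts S then ordS x
  else if ord_pred x \in adj_starts S then ord_pred x else x.

Lemma adj_swapK (n : nat) (S : {set 'I_n}) : involutive (adj_swap S).
Proof.
move=> x; rewrite /adj_swap.
case xS: (x \in adj_starts S).
  have sxS : (ordS x \in adj_starts S) = false.
    by move: xS; rewrite !inE ordSK => /andP[-> _]; rewrite andbF.
  by rewrite sxS ordSK xS.
by case pxS: (ord_pred x \in adj_starts S); rewrite ?xS ?pxS ?ord_predK.
Qed.

Definition flip (n : nat) (S : {set 'I_n}) : 'S_n := perm (inv_inj (adj_swapK S)).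

(** * Inversion sets and the order on the permutations w_S *)

Section Flips.
Variables (n : nat) (pi : 'S_n).
Implicit Types (S T : {set 'I_n}) (u v : 'S_n) (i j : 'I_n).
Local Notation good := (sparse_subsets (Asc pi)).

(** Pairs are recorded by value, so that exchanging two adjacent positions affects the status of a
    single pair. *)
Definition inversions u : {set 'I_n * 'I_n} :=
  [set p : 'I_n * 'I_n | (p.1 < p.2) && ((u^-1)%g p.2 < (u^-1)%g p.1)].

Lemma weak_coverP u v :
  reflect (exists i j, [/\ j = i.+1 :> nat, u i < u j & v = (tperm i j * u)%g])
          (weak_cover u v).
Proof.
apply: (iffP existsP) => [[i /existsP[j /and3P[/eqP ? ? /eqP ?]]]|[i [j [h1 h2 h3]]]].
  by exists i, j.
by exists i; apply/existsP; exists j; rewrite h1 h2 h3 !eqxx.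
Qed.

Lemma inversions_cover u i j : j = i.+1 :> nat -> u i < u j ->
  inversions (tperm i j * u) = (u i, u j) |: inversions u.
Proof.
move=> ji uij; apply/setP => -[a b]; rewrite !inE /= invMg tpermV !permM.
rewrite xpair_eqE -[a](permKV u) -[b](permKV u).
(* The values are replaced by their positions [x] and [y]; no position lies strictly between [i] and
   [j], so only the pair sitting there changes order. *)
move: (u^-1 a)%g (u^-1 b)%g => x y; rewrite !permK !(inj_eq perm_inj).
rewrite -!val_eqE /=.
case: (tpermP i j x) => [->|->|/eqP + /eqP +];
 case: (tpermP i j y) => [->|->|/eqP + /eqP +]; rewrite -?val_eqE /=; lia.
Qed.

Lemma inversions_le u v : weak_le u v -> inversions u \subset inversions v.
Proof.
case/connectP => p; elim: p u => [|w p IHp] u /=; first by move=> _ ->.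
case/andP => /weak_coverP[i [j [ji uij ->]]] /IHp{}IHp /IHp; apply: subset_trans.
by rewrite inversions_cover // subsetUr.
Qed.

(** [ordS] is cyclic, but an ascent is never the last position, so there it gives the true
    successor. *)
Lemma AscP i : i \in Asc pi -> ordS i = i.+1 :> nat /\ pi i < pi (ordS i).
Proof.
rewrite inE => /existsP[j /andP[/eqP ji pij]].
have e : ordS i = j.
  by apply/val_inj; rewrite /= -ji modn_small.
by rewrite e ji.
Qed.

(** A predecessor of [i] in [S] would be an ascent, so [i] would be its true successor, against
    sparsity. *)
Lemma starts_good S : S \in good -> adj_starts S = S.
Proof.
rewrite inE => /andP[/subsetP SA /sparseP spS].
apply/setP => i; rewrite inE; case iS: (i \in S) => //=; apply/negP => pS.
by apply: (spS _ _ pS iS); have [<- _] := AscP (SA _ pS); rewrite ord_predK.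
Qed.

Lemma good_pred S i : S \in good -> i \in S -> ord_pred i \notin S.
Proof.
by move=> gS; rewrite -{1}(starts_good gS) inE => /andP[].
Qed.

Lemma good_ordS S i : S \in good -> i \in S -> ordS i \notin S.
Proof.
by move=> gS iS; apply/negP => /(good_pred gS); rewrite ordSK iS.
Qed.

Lemma flipE S x : S \in good -> flip S x =
  if x \in S then ordS x else if ord_pred x \in S then ord_pred x else x.
Proof. by move=> gS; rewrite permE /adj_swap starts_good. Qed.

(** Only exchanges starting at [i] or at one of its two neighbours can move these positions, and
    none of the three is in [S]. *)
Lemma flip_fix S i : i |: S \in good -> i \notin S ->
  flip S i = i /\ flip S (ordS i) = ordS i.
Proof.
move=> giS iS; have gS := sparse_subsetsS (subsetUr [set i] S) giS.
have iiS : i \in i |: S by rewrite setU11.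
have := good_ordS giS iiS; have := good_pred giS iiS.
rewrite !flipE // !in_setU1 ordSK (negbTE iS).
by move=> /norP[_ /negbTE ->] /norP[_ /negbTE ->].
Qed.

Lemma flipU1 S i : i |: S \in good -> i \notin S ->
  flip (i |: S) = (tperm i (ordS i) * flip S)%g.
Proof.
move=> giS iS; have gS := sparse_subsetsS (subsetUr [set i] S) giS.
have iiS : i \in i |: S by rewrite setU11.
have [fi fsi] := flip_fix giS iS.
have siS := good_ordS giS iiS.
apply/permP => x; rewrite permM.
case: tpermP => [->|->|xi xsi].
- by rewrite fsi flipE // iiS.
- by rewrite fi flipE // (negbTE siS) ordSK iiS.
rewrite !flipE // !in_setU1; move/eqP/negbTE: (xi) => ->.
rewrite (_ : (ord_pred x == i) = false) //.
by apply/eqP => e; apply: xsi; rewrite -e ord_predK.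
Qed.

(** [wt S] is w_S, and [pr i] is the inversion created by the exchange at an ascent [i]. *)
Local Notation wt S := (flip S * pi)%g.
Local Notation pr i := (pi i, pi (ordS i)).

Lemma flip0 : wt set0 = pi.
Proof.
by apply/permP => x; rewrite permM permE /adj_swap !inE.
Qed.

(** The exchanges in [S] leave the entries at [i] and its successor in place, so they still form an
    ascent of [wt S]. *)
Lemma wt_cover S i : i |: S \in good -> i \notin S ->
  [/\ wt (i |: S) = (tperm i (ordS i) * wt S)%g,
      wt S i = pi i, wt S (ordS i) = pi (ordS i), weak_cover (wt S) (wt (i |: S))
    & inversions (wt (i |: S)) = pr i |: inversions (wt S)].
Proof.
move=> giS iS; have [fi fsi] := flip_fix giS iS.
have [sui pii] : ordS i = i.+1 :> nat /\ pi i < pi (ordS i).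
  apply: AscP; move: giS; rewrite inE => /andP[/subsetP + _]; apply.
  exact: setU11.
have e : wt (i |: S) = (tperm i (ordS i) * wt S)%g by rewrite flipU1 // mulgA.
have ei : wt S i = pi i by rewrite permM fi.
have esi : wt S (ordS i) = pi (ordS i) by rewrite permM fsi.
split=> //; first by apply/weak_coverP; exists i, (ordS i); rewrite ei esi.
by rewrite e inversions_cover // ei esi.
Qed.

Lemma pr_inj i j : pr i = pr j -> i = j.
Proof. by case=> /perm_inj. Qed.

Lemma inversions_wt S : S \in good ->
  inversions (wt S) = [set pr i | i in S] :|: inversions pi.
Proof.
move: {2}(#|S|) (erefl #|S|) => s; elim: s S => [|s IHs] S.
  by move/eqP; rewrite cards_eq0 => /eqP -> _; rewrite flip0 imset0 set0U.
move=> cS gS; have /set0Pn[i iS] : S != set0 by rewrite -cards_eq0 cS.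
move: cS gS; rewrite -(setD1K iS); have := setD11 i S.
move: (S :\ i) => T iT; rewrite cardsU1 iT => -[cT] giT.
have gT := sparse_subsetsS (subsetUr [set i] T) giT.
have [_ _ _ _ ->] := wt_cover giT (negbT iT).
by rewrite IHs // imsetU1 setUA.
Qed.

Lemma pr_notin_pi S i : S \in good -> i \in S -> pr i \notin inversions pi.
Proof.
rewrite inE => /andP[/subsetP SA _] /SA /AscP[si _].
by rewrite inE /= !permK si; lia.
Qed.

(** Inversion sets thus recover [T] from [wt T]. Membership of [i] in [S] makes it an ascent, so
    that [pr i] is not already an inversion of [pi]. *)
Lemma pr_in_wt S T i : S \in good -> i \in S -> T \in good ->
  (pr i \in inversions (wt T)) = (i \in T).
Proof.
move=> gS iS gT; rewrite inversions_wt // in_setU (negbTE (pr_notin_pi gS iS)) orbF.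
apply/imsetP/idP => [[j jT /pr_inj -> //]|iT]; by exists i.
Qed.

Lemma wt_le S T : S \in good -> T \in good -> weak_le (wt S) (wt T) = (S \subset T).
Proof.
move=> gS gT; apply/idP/idP => [/inversions_le /subsetP H|].
  apply/subsetP => i iS; rewrite -(pr_in_wt gS iS gT); apply: H.
  by rewrite (pr_in_wt gS iS gS).
(* For the converse, removing from [T] one element outside [S] steps down by one cover. *)
move: {2}(#|T :\: S|) (erefl #|T :\: S|) => s; elim: s T gT => [|s IHs] T gT.
  move/eqP; rewrite cards_eq0 setD_eq0 => TS ST.
  have -> : T = S by apply/eqP; rewrite eqEsubset TS.
  exact: connect0.
move=> cTS ST; have /set0Pn[i] : T :\: S != set0 by rewrite -cards_eq0 cTS.
rewrite inE => /andP[iS iT].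
have gT' := sparse_subsetsS (subD1set T i) gT.
have gT2 : i |: T :\ i \in good by rewrite setD1K.
have [_ _ _ cov _] := wt_cover gT2 (negbT (setD11 i T)).
rewrite setD1K // in cov; apply: connect_trans (connect1 cov); apply: IHs => //.
  by move: cTS; rewrite (cardsD1 i) !inE iS iT setDDl setUC -setDDl => -[].
by rewrite subsetD1 ST iS.
Qed.

(* A cover of [wt S] creates a single new inversion, and that inversion
   determines the transposition. *)
Lemma wt_cover_unique S i v : i |: S \in good -> i \notin S ->
  weak_cover (wt S) v -> pr i \in inversions v -> v = wt (i |: S).
Proof.
move=> giS iS /weak_coverP[a [b [ba ab ->]]].
have gS := sparse_subsetsS (subsetUr [set i] S) giS.
have [-> ei esi _ _] := wt_cover giS iS.
rewrite inversions_cover // in_setU1 (pr_in_wt giS (setU11 _ _)) // (negbTE iS) orbF.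
rewrite -{1}ei -{1}esi xpair_eqE !(inj_eq perm_inj) => /andP[/eqP <- /eqP <-].
by [].
Qed.

(** * Boolean intervals with minimum [pi] *)

Lemma below_wt S u : S \in good -> weak_le pi u -> weak_le u (wt S) ->
  exists2 T : {set 'I_n}, T \subset S & u = wt T.
Proof.
(* Induction on a chain from [pi], peeling off its last cover, so that the element before [u] is
   already some [wt T]. *)
move=> gS /connectP[p]; elim/last_ind: p u => [|p v IHp] u /=.
  by move=> _ -> _; exists set0; rewrite ?sub0set ?flip0.
rewrite rcons_path last_rcons => /andP[pp cov] -> {u} vS.
have [|T TS eT] := IHp _ pp (erefl _); first exact: connect_trans (connect1 cov) vS.
rewrite eT in cov; have gT := sparse_subsetsS TS gS.
have [a [b [ba ab ev]]] := weak_coverP _ _ cov.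
have new : (wt T a, wt T b) \notin inversions (wt T).
  by rewrite inE /= !permK ba; lia.
have inv : (wt T a, wt T b) \in inversions v by rewrite ev inversions_cover // setU11.
(* The new inversion survives in [wt S] and is not one of [pi], so it is [pr i] for some [i] in
   [S]. *)
have := subsetP (inversions_le vS) _ inv; move: new.
rewrite !inversions_wt // !in_setU negb_or => /andP[nT /negbTE ->]; rewrite orbF.
case/imsetP => i iS ei; rewrite ei in inv nT.
have iT : i \notin T by apply: contra nT => iT; apply/imsetP; exists i.
have iTS : i |: T \subset S by rewrite subUset sub1set iS.
exists (i |: T) => //; exact: wt_cover_unique (sparse_subsetsS iTS gS) iT cov inv.
Qed.

Lemma interval_wt S : S \in good ->
  interval pi (wt S) = [set wt T | T : {set 'I_n} in powerset S].
Proof.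
move=> gS; have g0 := sparse_subsetsS (sub0set S) gS.
apply/setP => u; rewrite inE; apply/andP/imsetP.
  by case=> pu uS; have [T TS ->] := below_wt gS pu uS; exists T; rewrite ?powersetE.
case=> T; rewrite powersetE => TS ->; have gT := sparse_subsetsS TS gS.
by rewrite -{1}flip0 !wt_le // sub0set.
Qed.

Lemma boolean_wt S : S \in good -> boolean_interval pi (wt S).
Proof.
move=> gS; have g0 := sparse_subsetsS (sub0set S) gS.
split; first by rewrite -{1}flip0 wt_le // sub0set.
exists #|S|; exists (fun X : {set 'I_#|S|} => wt (enum_val @: X)).
have sub (X : {set 'I_#|S|}) : enum_val @: X \subset S.
  by apply/subsetP => _ /imsetP[x _ ->]; apply: enum_valP.
have gX (X : {set 'I_#|S|}) := sparse_subsetsS (sub X) gS.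
have mono (X Y : {set 'I_#|S|}) : (X \subset Y) = weak_le (wt (enum_val @: X)) (wt (enum_val @: Y)).
  rewrite wt_le //; apply/idP/idP => [|/subsetP H]; first exact: imsetS.
  apply/subsetP => x xX; have /imsetP[y yY /enum_val_inj ->] := H _ (imset_f enum_val xX).
  by [].
split=> //.
  by move=> X Y e; apply/eqP; rewrite eqEsubset !mono e /weak_le connect0.
rewrite interval_wt //; apply/setP => u; apply/imsetP/imsetP => [[X _ ->]|[T]].
  by exists (enum_val @: X); rewrite ?powersetE.
rewrite powersetE => TS ->; exists [set x | enum_val x \in T]; rewrite ?inE //.
congr (wt _); apply/setP => i; apply/idP/imsetP => [iT|[x]]; last by rewrite inE => ? ->.
have iS := subsetP TS _ iT.
by exists (enum_rank_in iS i); rewrite ?inE enum_rankK_in.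
Qed.

(** The set is read off the atoms: [g x] is the position exchanged to reach [f [set x]], and [S] is
    the image of [g]. *)
Lemma boolean_interval_wt w : boolean_interval pi w ->
  exists2 S : {set 'I_n}, S \in good & w = wt S.
Proof.
case=> piw [k [f [finj fI mono]]].
have inI X : f X \in interval pi w by rewrite -fI imset_f.
have fP u : weak_le pi u -> weak_le u w -> exists X, u = f X.
  move=> pu uw; have : u \in interval pi w by rewrite inE pu.
  by rewrite -fI => /imsetP[X _ ->]; exists X.
have fT : f setT = w.
  have [X eX] := fP w piw (connect0 _ _).
  have := inI setT; rewrite inE [in weak_le _ w]eX -mono subTset => /andP[_ /eqP eT].
  by rewrite eX eT.
have f0 : f set0 = pi.
  have [X eX] := fP pi (connect0 _ _) piw.
  have := inI set0; rewrite inE [in weak_le pi _]eX -mono subset0 => /andP[/eqP e0 _].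
  by rewrite eX e0.
(* The first cover on a chain from [f X] to [f (x |: X)] stays in the interval, hence is [f Y] with
   [Y] between [X] and [x |: X]; [Y = X] is impossible because a cover creates an inversion. *)
have cov (X : {set 'I_k}) x : x \notin X -> weak_cover (f X) (f (x |: X)).
  move=> xX; have le : weak_le (f X) (f (x |: X)) by rewrite -mono subsetUr.
  have [p pp e] := connectP le.
  case: p pp e => [_ e|u p /= /andP[cu pp] e].
    by move/finj: e => e; rewrite -e setU11 in xX.
  have uU : weak_le u (f (x |: X)) by apply/connectP; exists p.
  have := inI X; rewrite inE => /andP[piX _].
  have := inI (x |: X); rewrite inE => /andP[_ Uw].
  have [Y eY] := fP u (connect_trans piX (connect1 cu)) (connect_trans uU Uw).
  have XY : X \subset Y by rewrite mono -eY; apply: connect1.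
  rewrite eY -mono in uU; rewrite eY in cu.
  case xY: (x \in Y).
    rewrite (_ : x |: X = Y) //; apply/eqP.
    by rewrite eqEsubset uU subUset sub1set xY XY.
  have eXY : Y = X.
    apply/eqP; rewrite eqEsubset XY andbT -(setU1K xX).
    by rewrite subsetD1 uU xY.
  move: cu; rewrite eXY => /weak_coverP[i [j [ji fij e']]].
  have := setU11 (f X i, f X j) (inversions (f X)).
  by rewrite -inversions_cover // -e' inE /= !permK => /andP[_]; rewrite ji ltnNge leqnSn.
have /fin_all_exists[g gP] (x : 'I_k) : exists i : 'I_n, i \in Asc pi /\ f [set x] = (tperm i (ordS i) * pi)%g.
  have := cov set0 x; rewrite inE setU0 f0 => /(_ isT) /weak_coverP[i [j [ji pij ->]]].
  have iA : i \in Asc pi by rewrite inE; apply/existsP; exists j; rewrite ji eqxx.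
  exists i; split=> //; congr (tperm _ _ * _)%g; apply/ord_inj.
  by have [e _] := AscP iA; rewrite e.
have gA x : g x \in Asc pi by case: (gP x).
have fg x : f [set x] = (tperm (g x) (ordS (g x)) * pi)%g by case: (gP x).
have ginj : injective g by move=> x y e; apply/set1_inj/finj; rewrite !fg e.
have invg x : inversions (f [set x]) = pr (g x) |: inversions pi.
  by have [? ?] := AscP (gA x); rewrite fg inversions_cover.
have prnot x : pr (g x) \notin inversions pi.
  by have [e _] := AscP (gA x); rewrite inE /= !permK e; lia.
have prf x (X : {set 'I_k}) : x \in X -> pr (g x) \in inversions (f X).
  rewrite -sub1set mono => /inversions_le /subsetP; apply.
  by rewrite invg setU11.
(* If [g y] followed [g x], the cover from [f [set x]] to [f (y |: [set x])] would have to exchange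
   the values [pi (g y)] and [pi (ordS (g y))]. In [f [set x]] the former has moved to [g x], so
   they are not adjacent. *)
have sp : sparse (g @: [set: 'I_k]).
  apply/sparseP => _ _ /imsetP[x _ ->] /imsetP[y _ ->] gyx.
  have [gx pgx] := AscP (gA x); have [gy pgy] := AscP (gA y).
  have eyx : g y = ordS (g x) by apply/ord_inj; rewrite gyx -gx.
  have yx : y != x by apply/eqP => e; move: gyx; rewrite e; lia.
  have := cov [set x] y; rewrite inE => /(_ yx) /weak_coverP[a [b [ba ab e]]].
  have := prf y (y |: [set x]) (setU11 _ _).
  rewrite e inversions_cover // in_setU1 invg in_setU1 (negbTE (prnot y)) orbF.
  case/orP=> [|/eqP/pr_inj/ginj exy]; last by rewrite exy eqxx in yx.
  have e1 : pi (g y) = f [set x] (g x) by rewrite fg permM tpermL eyx.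
  rewrite xpair_eqE {1}e1 (inj_eq perm_inj) => /andP[/eqP ea].
  have eb : b = g y by apply/ord_inj; rewrite ba gyx ea.
  rewrite eb {2}eyx fg permM tpermR (inj_eq perm_inj) => /eqP.
  by move/(congr1 val) => /=; move: gy gyx; simpl; lia.
have gg (X : {set 'I_k}) : g @: X \in good.
  rewrite inE (sparseS _ sp) ?imsetS ?subsetT // andbT.
  by apply/subsetP => _ /imsetP[x _ ->].
(* Both sides grow from [pi] by covers creating the inversions [pr (g x)], and such a cover is
   unique. *)
have main (X : {set 'I_k}) : f X = wt (g @: X).
  move: {2}(#|X|) (erefl #|X|) => s; elim: s X => [|s IHs] X.
    by move/eqP; rewrite cards_eq0 => /eqP ->; rewrite imset0 flip0.
  move=> cX; have /set0Pn[x xX] : X != set0 by rewrite -cards_eq0 cX.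
  move: cX; rewrite -(setD1K xX); have := setD11 x X.
  move: (X :\ x) => Y xY; rewrite cardsU1 xY => -[cY].
  rewrite imsetU1; apply: wt_cover_unique.
  - by rewrite -imsetU1.
  - by rewrite (mem_imset _ _ ginj) xY.
  - by rewrite -IHs //; apply: cov; rewrite xY.
  - by apply: prf; rewrite setU11.
by exists (g @: setT); rewrite // -main fT.
Qed.

(** Intervals are counted as sets of permutations, so distinct [S] must give distinct sets: each
    interval contains its top, and equal intervals force each top below the other. *)
Lemma card_boolean_intervals : #|boolean_intervals_from pi| = #|good|.
Proof.
have -> : boolean_intervals_from pi = [set interval pi (wt S) | S in good].
  apply/setP => I; apply/imsetP/imsetP => [[w]|[S gS ->]].
    by rewrite inE => /asboolP /boolean_interval_wt[S gS ->] ->; exists S.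
  by exists (wt S) => //; rewrite inE; apply/asboolP/boolean_wt.
apply: card_in_imset => S T gS gT e.
have sub A B : A \in good -> B \in good ->
  interval pi (wt A) = interval pi (wt B) -> A \subset B.
  move=> gA gB eAB; have := connect0 (@weak_cover n) (wt A).
  rewrite -wt_le //; have : wt A \in interval pi (wt A).
    by rewrite inE /weak_le connect0 andbT; case: (boolean_wt gA).
  by rewrite eAB inE => /andP[].
by apply/eqP; rewrite eqEsubset !sub.
Qed.

End Flips.

Theorem theorem1p1 (n : nat) (hn : 1 <= n) (pi : 'S_n) :
  #|boolean_intervals_from pi| = \prod_(B in maximal_blocks (Asc pi)) fib (#|B| + 2).
Proof. by rewrite card_boolean_intervals card_sparse_blocks. Qed.
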